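(* Let $r$ and $R$ be positive integers. Then the multivariate rational function $$f(x,y,t):=\frac{(1-xy)(1-tx^r)(1-ty^R)+(1-t^2)(x-x^r)(y-y^R)}{(1-tx^r)(1-ty^R)(1-x)(1-y)(1-tx)(1-ty)},$$ with $|x|<1$, $|y|<1$, and $|t|<1$, has nonnegative coefficients when written as a power series (in the three variables $x,y,t$) centered at $(0,0,0)$. *)

(* Defs.v *)
From HB Require Import structures.
From mathcomp Require Import all_boot all_order all_algebra finmap.
From mathcomp Require Import all_classical all_reals all_analysis.
From mathcomp.analysis.showcase Require Import summability.
From mathcomp.real_closed Require Import complex.

Set Implicit Arguments.
Unset Strict Implicit.
Unset Printing Implicit Defensive.

Import Order.TTheory GRing.Theory Num.Theory numFieldNormedType.Exports.

Local Open Scope classical_set_scope.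
Local Open Scope ring_scope.
Local Open Scope complex_scope.

(* The exponents [r], [s] stand for r and R (here [R] is the real field). *)
Definition ratfun (K : fieldType) (r s : nat) (x y t : K) : K :=
  ((1 - x * y) * (1 - t * x ^+ r) * (1 - t * y ^+ s)
     + (1 - t ^+ 2) * (x - x ^+ r) * (y - y ^+ s))
  / ((1 - t * x ^+ r) * (1 - t * y ^+ s)
     * (1 - x) * (1 - y) * (1 - t * x) * (1 - t * y)).

(* [f] is the sum of the power series with coefficients [c] on the open unit
   polydisc. Convergence is along the net of finite sets of exponents
   [(i, j, k)], i.e. unconditional, equivalently absolute. *)
Definition power_series_on_polydisc (R : realType)
    (f : R[i] -> R[i] -> R[i] -> R[i]) (c : nat -> nat -> nat -> R[i]) : Prop :=
  forall x y t : R[i], `|x| < 1 -> `|y| < 1 -> `|t| < 1 ->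
    partial_sum (fun m : nat * nat * nat =>
        let: (i, j, k) := m in
        c i j k * x ^+ i * y ^+ j * t ^+ k : R[i]^o) @ totally
      --> (f x y t : R[i]^o).

(* Main.v *)
Require Import Defs.
From mathcomp Require Import all_boot all_order all_algebra finmap.
From mathcomp Require Import all_classical all_reals all_analysis.
From mathcomp.analysis.showcase Require Import summability.
From mathcomp.real_closed Require Import complex.
From mathcomp Require Import zify ring.
Import Order.TTheory GRing.Theory Num.Theory numFieldNormedType.Exports.
Local Open Scope ring_scope.
Local Open Scope complex_scope.

(** Write p = i %/ r and q = j %/ s. The partial fractions

      1 / (1 - t x) - (1 - x^r) / ((1 - x) (1 - t x^r))
        = - (1 - t) (x - x^r) / ((1 - x) (1 - t x) (1 - t x^r))

    and the generating function

      \sum_i x^i t^(i %/ r) = (1 - x^r) / ((1 - x) (1 - t x^r))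

    turn the rational function into a double series whose coefficient of
    x^i y^j is

      (t^i + t^j + (1 + t) (t^(p + q) - t^(p + j) - t^(i + q))) / (1 - t);

    the two occurrences of t^(i + j), one from each summand of the numerator,
    cancel. As t^e / (1 - t) is the sum of the t^k with e <= k, the
    coefficient of x^i y^j t^k is a signed count of the eight inequalities
    e <= k, with e among i, j, p + q, p + q + 1 (positive) and p + j,
    p + j + 1, i + q, i + q + 1 (negative). Since p <= i and q <= j, each
    inequality of the second kind that holds can be matched with one of the
    first kind that holds too: this is [coef_neg_le_pos], the combinatorial
    heart of the positivity.

    Convergence over finite sets of exponents is obtained for each of the
    eight families separately. A family is supported on the epigraph of a
    function a i + b j + d, and the map (i, j, k) |-> (i, j, a i + b j + d + k)
    carries cubes to finite sets that exhaust this epigraph and over which the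
    sum is a product of three one-variable sums ([sum_epi_term]). The same
    computation with absolute values gives absolute convergence, so that
    these special finite sets suffice ([cvg_partial_sum_exhaustion]). It
    remains to sum the one-variable series ([cvg_twisted_geom_div]) and to
    recombine the eight values ([ratfunE]). *)

Set Implicit Arguments.
Unset Strict Implicit.

#[local] Existing Instance totally_filter.

(** * Unconditional sums along an exhaustion *)

Lemma big_fset_subsetD (V : nmodType) (I : choiceType) (A B : {fset I})
    (F : I -> V) : (A `<=` B)%fset ->
  \sum_(i <- B) F i = \sum_(i <- A) F i + \sum_(i <- (B `\` A)%fset) F i.
Proof.
move=> sAB; rewrite (big_fsetID _ (mem A)) /=; congr (_ + _).
  by apply: eq_fbigl => i; rewrite !inE -in_fsetI (fsetIidPr sAB).
by apply: eq_fbigl => i; rewrite !inE andbC.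
Qed.

Lemma ler_sum_fset (K : numDomainType) (I : choiceType) (A B : {fset I})
    (F : I -> K) : (forall i, 0 <= F i) -> (A `<=` B)%fset ->
  \sum_(i <- A) F i <= \sum_(i <- B) F i.
Proof.
by move=> F0 sAB; rewrite (big_fset_subsetD F sAB) lerDl sumr_ge0.
Qed.

(** Only the points of J satisfying P have to be caught: the increasing sets
    used below exhaust the support of a family, not the whole index type. *)
Lemma homo_fset_cover (I : choiceType) (E : nat -> {fset I}) (P : pred I)
    (J : {fset I}) (N : nat) :
  {homo E : m n / (m <= n)%N >-> (m `<=` n)%fset} ->
  (forall i, P i -> exists n, i \in E n) ->
  exists2 M, (N <= M)%N & forall i, i \in J -> P i -> i \in E M.
Proof.
move=> homoE cov.
suff [M NM H] : exists2 M, (N <= M)%N &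
    forall i, i \in (enum_fset J) -> P i -> i \in E M by exists M.
elim: (enum_fset J) => [|a s [M NM IH]]; first by exists N.
have [Pa|nPa] := boolP (P a); last first.
  by exists M => // i; rewrite inE => /predU1P[-> /(negP nPa)//|]; exact: IH.
have [n an] := cov _ Pa; exists (maxn M n) => [|i].
  by rewrite leq_max NM.
rewrite inE => /predU1P[-> _|si Pi].
  by apply: (fsubsetP (homoE n _ _)) an; rewrite leq_maxr.
by apply: (fsubsetP (homoE M _ _)); rewrite ?leq_maxl ?IH.
Qed.

(** A finite set J containing E N meets the support of u inside some larger
    E M, so the sum over J differs from the sum over E N by at most the
    increment of the absolute sums between E N and E M; that increment is
    small because the absolute sums converge. The limits are given rather than
    constructed, which is why no completeness is involved. *)
Lemma cvg_partial_sum_exhaustion (K : numFieldType) (I : choiceType)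
    (u : I -> K^o) (E : nat -> {fset I}) (s w : K^o) :
  {homo E : m n / (m <= n)%N >-> (m `<=` n)%fset} ->
  (forall i, u i != 0 -> exists n, i \in E n) ->
  (\sum_(i <- E n) `|u i| @[n --> \oo] --> w)%classic ->
  (\sum_(i <- E n) u i @[n --> \oo] --> s)%classic ->
  (partial_sum u @ totally --> s)%classic.
Proof.
move=> homoE cov /cvgrPdist_lt cw /cvgrPdist_lt cs.
apply/cvgrPdist_lt => e e0.
have e2 : 0 < e / 2 by rewrite divr_gt0.
have e4 : 0 < e / 4 by rewrite divr_gt0.
have [N _ HN] : (\forall n \near \oo,
    `|s - \sum_(i <- E n) u i| < e / 2 /\
    `|w - \sum_(i <- E n) `|u i| | < e / 4)%classic.
  by near=> n; split; near: n; [exact: cs|exact: cw].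
exists (E N) => //= J EJ.
have -> : partial_sum u J = \sum_(i <- J) u i by rewrite big_seq_fsetE.
have [M NM JM] := homo_fset_cover J N homoE cov.
rewrite (big_fset_subsetD u EJ) opprD addrA.
set d := \sum_(i <- (J `\` E N)%fset) u i.
have dW : `|d| <= \sum_(i <- E M) `|u i| - \sum_(i <- E N) `|u i|.
  apply: le_trans (ler_norm_sum _ _ _) _.
  rewrite (big_fset_subsetD (fun i => `|u i|) (homoE _ _ NM)) addrAC subrr add0r.
  rewrite -(@big_fset_incl _ _ _ _ ((J `\` E N) `&` E M)%fset).
  - apply: ler_sum_fset => //; apply/fsubsetP => i.
    by rewrite !inE => /andP[/andP[-> _] ->].
  - exact: fsubsetIl.
  - move=> i iJ; rewrite in_fsetI iJ /=; case: (eqVneq (u i) 0) => [->|ui].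
      by rewrite normr0.
    by rewrite JM //; move: iJ; rewrite inE => /andP[].
have [HsN HwN] := HN N (leqnn N); have [_ HwM] := HN M NM.
have dlt : `|d| < e / 2.
  apply: (le_lt_trans (le_trans dW (real_ler_norm _))).
    by rewrite rpredB// ger0_real// sumr_ge0.
  rewrite (_ : _ - _ = (w - \sum_(i <- E N) `|u i|)
                       - (w - \sum_(i <- E M) `|u i|)); last by ring.
  apply: le_lt_trans (ler_normB _ _) _.
  by rewrite (_ : e / 2 = e / 4 + e / 4) ?ltrD//; field.
apply: le_lt_trans (ler_normB _ _) _.
by rewrite [ltRHS](splitr e) ltrD.
Unshelve. all: by end_near. Qed.

(** * Power series supported on the epigraph of a separable function *)

Definition cube (n : nat) : {fset nat * nat * nat} :=
  seq_fset tt
    [seq (ij, k) | ij <- [seq (i, j) | i <- index_iota 0 n, j <- index_iota 0 n],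
                   k <- index_iota 0 n].

Lemma in_cube (n i j k : nat) :
  ((i, j, k) \in cube n) = [&& (i < n)%N, (j < n)%N & (k < n)%N].
Proof.
rewrite seq_fsetE; apply/allpairsP/and3P.
  move=> [[[a b] c] /= [/allpairsP[[a' b'] /= [ha hb [-> ->]]] hc [-> -> ->]]].
  by move: ha hb hc; rewrite !mem_index_iota.
move=> [hi hj hk]; exists ((i, j), k); split=> //=; rewrite ?mem_index_iota //.
by apply/allpairsP; exists (i, j); rewrite /= !mem_index_iota.
Qed.

Lemma big_cube (V : nmodType) (n : nat) (F : nat * nat * nat -> V) :
  \sum_(m <- cube n) F m =
  \sum_(0 <= i < n) \sum_(0 <= j < n) \sum_(0 <= k < n) F (i, j, k).
Proof.
rewrite (perm_big _ (seq_fset_perm _ _)) undup_id ?big_allpairs //=.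
by rewrite !allpairs_uniq ?iota_uniq //= => -[? ?] [? ?] _ _ [-> ->].
Qed.

Definition twisted_geom (K : pzSemiRingType) (z q : K) (a : nat -> nat)
    (n : nat) : K :=
  \sum_(0 <= i < n) z ^+ i * q ^+ a i.

(** Absolute convergence asks for a limit of the absolute sums, and not just
    for a bound, because the field need not be complete. *)
Definition abs_cvg_twisted_geom (K : numFieldType) (z q : K) (a : nat -> nat)
    (s : K) :=
  (twisted_geom z q a @ \oo --> (s : K^o))%classic /\
  exists w : K, (twisted_geom `|z| `|q| a @ \oo --> (w : K^o))%classic.

Section Epigraph.
Variables (a b : nat -> nat) (d : nat).

Definition epi_term (K : pzSemiRingType) (x y t : K) (m : nat * nat * nat) : K :=
  let: (i, j, k) := m in
  (a i + b j + d <= k)%N%:R * x ^+ i * y ^+ j * t ^+ k.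

Definition epi_shift (m : nat * nat * nat) :=
  let: (i, j, k) := m in (i, j, (a i + b j + d + k)%N).

Lemma epi_shift_inj : injective epi_shift.
Proof. by move=> [[i j] k] [[i' j'] k'] /= [-> -> /addnI ->]. Qed.

Lemma in_epi_shift_cube (n i j k : nat) :
  (epi_shift (i, j, k) \in [fset epi_shift m | m in cube n]%fset) =
  [&& (i < n)%N, (j < n)%N & (k < n)%N].
Proof. by rewrite mem_imfset ?in_cube//; exact: epi_shift_inj. Qed.

(** After the shift the indicator is constantly 1 and the exponent of t is
    a sum of functions of one index each, so the triple sum factors. *)
Lemma sum_epi_term (K : comPzRingType) (x y t : K) (n : nat) :
  \sum_(m <- [fset epi_shift m | m in cube n]%fset) epi_term x y t m =
  t ^+ d * (twisted_geom x t a n * twisted_geom y t b n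
            * twisted_geom t 1 (fun=> 0%N) n).
Proof.
rewrite big_imfset /=; last by move=> ? ? _ _ /epi_shift_inj.
rewrite big_cube /twisted_geom !mulr_suml mulr_sumr; apply: eq_bigr => i _.
rewrite -mulrA mulr_suml !mulr_sumr; apply: eq_bigr => j _.
rewrite !mulr_sumr; apply: eq_bigr => k _ /=.
by rewrite leq_addr -[nat_of_bool true]/1%N expr0 !exprD; ring.
Qed.

Lemma cvg_epi_term (K : numFieldType) (x y t A B C : K) :
  abs_cvg_twisted_geom x t a A -> abs_cvg_twisted_geom y t b B ->
  abs_cvg_twisted_geom t 1 (fun=> 0%N) C ->
  (partial_sum (epi_term x y t : _ -> K^o) @ totally
     --> (t ^+ d * (A * B * C) : K^o))%classic.
Proof.
move=> [cA [A' cA']] [cB [B' cB']] [cC [C' cC']]; rewrite normr1 in cC'.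
pose E n := [fset epi_shift m | m in cube n]%fset.
have cvgE (x' y' t' u v w : K^o) :
    (twisted_geom x' t' a @ \oo --> (u : K^o))%classic ->
    (twisted_geom y' t' b @ \oo --> (v : K^o))%classic ->
    (twisted_geom t' 1 (fun=> 0%N) @ \oo --> (w : K^o))%classic ->
    ((\sum_(m <- E n) epi_term x' y' t' m : K^o) @[n --> \oo]
      --> (t' ^+ d * (u * v * w) : K^o))%classic.
  move=> cu cv cw; under eq_fun do rewrite sum_epi_term.
  by apply: cvgM; [exact: cvg_cst|]; apply: cvgM cw; exact: cvgM.
apply: (@cvg_partial_sum_exhaustion _ _ _ E _ (`|t| ^+ d * (A' * B' * C'))).
- move=> m n mn; apply/fsubsetP => _ /imfsetP[[[i j] k] /= + ->].
  by rewrite in_cube in_epi_shift_cube => /and3P[*]; rewrite !(leq_trans _ mn).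
- move=> [[i j] k] /=; case: leqP => [le_k _|_]; last by rewrite !mul0r eqxx.
  exists (maxn i (maxn j k)).+1.
  rewrite (_ : (i, j, k) = epi_shift (i, j, k - (a i + b j + d)))%N.
    by rewrite in_epi_shift_cube; apply/and3P; split; lia.
  by rewrite /= subnKC.
- rewrite (_ : (fun n => _) =
      (fun n => \sum_(m <- E n) epi_term `|x| `|y| `|t| m)); first exact: cvgE.
  apply/funext => n; apply: eq_bigr => -[[i j] k] _ /=.
  by rewrite !normrM !normrX normr_nat.
- exact: cvgE.
Qed.

End Epigraph.

(** * The one-variable series *)

Lemma cvg_expr_complex (R : realType) (x : R[i]) :
  `|x| < 1 -> ((x ^+ n : R[i]^o) @[n --> \oo] --> (0 : R[i]^o))%classic.
Proof.
move=> x1; apply/cvgr0Pnorm_lt => e e0.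
move: (e0); rewrite ltcE /= => /andP[/eqP ei er].
move: x1; rewrite normc_def ltcR; set a := Num.sqrt _ => a1.
have a0 : 0 <= a by exact: sqrtr_ge0.
have /(_ _)/cvgr0Pnorm_lt/(_ _ er) := @cvg_expr R a.
rewrite ger0_norm // => /(_ a1).
apply: filterS => n; rewrite !normrX normc_def -/a.
rewrite ger0_norm // => H.
by rewrite -rmorphXn /= ltcE /= ei eqxx.
Qed.

Lemma subr1_neq0 (K : numDomainType) (z : K) : `|z| < 1 -> 1 - z != 0.
Proof.
by rewrite subr_eq0; apply: contraTneq => <-; rewrite normr1 ltxx.
Qed.

Lemma normrMX_lt1 (K : numDomainType) (q z : K) (n : nat) :
  (0 < n)%N -> `|q| <= 1 -> `|z| < 1 -> `|q * z ^+ n| < 1.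
Proof.
move=> n0 q1 z1; rewrite normrM normrX.
apply: le_lt_trans (_ : _ <= `|z| ^+ n) _; first by rewrite ler_piMl ?exprn_ge0.
by rewrite exprn_ilt1 // -lt0n.
Qed.

(** Raising the index by r multiplies a term by q x^r. Hence the partial sum
    S (n + r) is both S n plus r further terms, which tend to 0, and the
    geometric sum of the first r terms plus q x^r S n. Comparing the two gives
    S n in closed form up to a null sequence. *)
Lemma cvg_twisted_geom_div (R : realType) (r : nat) (x q : R[i]) :
  (0 < r)%N -> `|x| < 1 -> `|q| <= 1 ->
  (twisted_geom x q (divn^~ r) @ \oo -->
    ((1 - x ^+ r) / ((1 - x) * (1 - q * x ^+ r)) : R[i]^o))%classic.
Proof.
move=> r0 x1 q1.
pose S n : R[i]^o := twisted_geom x q (divn^~ r) n.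
pose a i : R[i]^o := x ^+ i * q ^+ (i %/ r).
have x1' := subr1_neq0 x1.
have xq1 : 1 - q * x ^+ r != 0 by apply/subr1_neq0/normrMX_lt1.
have a0 : (a n @[n --> \oo] --> (0 : R[i]^o))%classic.
  apply/cvgr0Pnorm_lt => e e0.
  have /cvgr0Pnorm_lt/(_ e e0) := cvg_expr_complex x1.
  apply: filterS => n; apply: le_lt_trans.
  by rewrite normrM ler_piMr // normrX exprn_ile1.
have tail m :
    ((\sum_(0 <= i < m) a (n + i)%N : R[i]^o) @[n --> \oo]
       --> (0 : R[i]^o))%classic.
  elim: m => [|m IH].
    by under eq_fun do rewrite big_geq //; exact: cvg_cst.
  under eq_fun do rewrite big_nat_recr //=.
  have am : (a (n + m)%N @[n --> \oo] --> (0 : R[i]^o))%classic.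
    by have := a0; rewrite -(cvg_shiftn m).
  by have := cvgD IH am; rewrite addr0 => H; exact: H.
have Sr n : (1 - q * x ^+ r) * S n =
    (1 - x ^+ r) / (1 - x) - \sum_(0 <= i < r) a (n + i)%N.
  have E1 : S (n + r)%N = S n + \sum_(0 <= i < r) a (n + i)%N.
    rewrite {1}/S /twisted_geom (@big_cat_nat _ _ _ n) ?leq_addr //=.
    congr (_ + _); rewrite -{1}[n]add0n big_addn addKn.
    by apply: eq_bigr => i _; rewrite addnC.
  have E2 : S (n + r)%N = (1 - x ^+ r) / (1 - x) + q * x ^+ r * S n.
    rewrite {1}/S /twisted_geom addnC (@big_cat_nat _ _ _ r) ?leq_addr //=.
    congr (_ + _).
      rewrite -(opprB _ 1) subrX1 -mulNr opprB mulrAC divff // mul1r big_mkord.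
      by apply: eq_bigr => i _; rewrite divn_small // expr0 mulr1.
    rewrite -{1}[r]add0n big_addn addKn mulr_sumr; apply: eq_bigr => i _.
    by rewrite divnDr // divnn r0 !exprD expr1; ring.
  rewrite mulrBl mul1r; apply/eqP; rewrite subr_eq addrAC eq_sym subr_eq.
  by rewrite -E1 E2.
rewrite (_ : (1 - x ^+ r) / _ =
    (1 - q * x ^+ r)^-1 * ((1 - x ^+ r) / (1 - x) - 0)).
  rewrite (_ : twisted_geom _ _ _ =
      (fun n => (1 - q * x ^+ r)^-1 * ((1 - x ^+ r) / (1 - x)
                  - \sum_(0 <= i < r) a (n + i)%N))).
    by apply: cvgM; [exact: cvg_cst|]; apply: cvgB; [exact: cvg_cst|exact: tail].
  by apply/funext => n; rewrite -Sr mulKf.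
by field; apply/andP.
Qed.

Lemma abs_cvg_twisted_geom_div (R : realType) (r : nat) (x q : R[i]) :
  (0 < r)%N -> `|x| < 1 -> `|q| <= 1 ->
  abs_cvg_twisted_geom x q (divn^~ r)
    ((1 - x ^+ r) / ((1 - x) * (1 - q * x ^+ r))).
Proof.
move=> r0 x1 q1; split; first exact: cvg_twisted_geom_div.
by eexists; apply: cvg_twisted_geom_div; rewrite ?normr_id.
Qed.

Lemma abs_cvg_twisted_geom_id (R : realType) (x q : R[i]) :
  `|x| < 1 -> `|q| <= 1 ->
  abs_cvg_twisted_geom x q (fun i => i) (1 - q * x)^-1.
Proof.
move=> x1 q1; have := abs_cvg_twisted_geom_div (ltn0Sn 0) x1 q1.
rewrite (_ : divn^~ 1%N = id); last by apply/funext => i; rewrite divn1.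
by rewrite expr1 invfM mulrA divff ?mul1r ?subr1_neq0.
Qed.

Lemma abs_cvg_twisted_geom_untwist (K : numFieldType) (z q s : K) :
  abs_cvg_twisted_geom z 1 id s -> abs_cvg_twisted_geom z q (fun=> 0%N) s.
Proof.
have E (z' q' : K) : twisted_geom z' 1 id = twisted_geom z' q' (fun=> 0%N).
  by apply/funext => n; apply: eq_bigr => i _; rewrite expr1n.
move=> [cz [w cw]]; rewrite normr1 in cw.
by split; [rewrite -E|exists w; rewrite -E].
Qed.

Lemma abs_cvg_twisted_geom_cst0 (R : realType) (x q : R[i]) :
  `|x| < 1 -> abs_cvg_twisted_geom x q (fun=> 0%N) (1 - x)^-1.
Proof.
move=> x1; apply: abs_cvg_twisted_geom_untwist.
by rewrite -{2}[x]mul1r; apply: abs_cvg_twisted_geom_id; rewrite ?normr1.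
Qed.

(** * The coefficients *)

Definition coef_pos (p q i j k : nat) : nat :=
  ((i <= k) + (j <= k) + (p + q <= k) + (p + q + 1 <= k))%N.

Definition coef_neg (p q i j k : nat) : nat :=
  ((p + j <= k) + (p + j + 1 <= k) + (i + q <= k) + (i + q + 1 <= k))%N.

(** If p + j <= k then j <= k and p + q <= k, which pays for p + j and
    p + j + 1 when i + q exceeds k; the other one-sided case is symmetric. If
    both p + j and i + q are at most k, then i, j and p + q are at most k, and
    the fourth positive inequality, p + q + 1 <= k, holds as soon as one of
    p + j + 1, i + q + 1 is at most k. *)
Lemma coef_neg_le_pos (p q i j k : nat) : (p <= i)%N -> (q <= j)%N ->
  (coef_neg p q i j k <= coef_pos p q i j k)%N.
Proof.
rewrite /coef_neg /coef_pos => pi qj.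
do !case: leqP => ? //=; lia.
Qed.

(** Each of the eight inequalities defines an epigraph family, those with the
    extra 1 contributing the summand t of the factor 1 + t. *)
Lemma cvg_coef (K : numFieldType) (a b : nat -> nat)
    (x y t Dx Dy Ox Oy Ux Uy Ot : K) :
  abs_cvg_twisted_geom x t id Dx -> abs_cvg_twisted_geom y t id Dy ->
  abs_cvg_twisted_geom x t (fun=> 0%N) Ox ->
  abs_cvg_twisted_geom y t (fun=> 0%N) Oy ->
  abs_cvg_twisted_geom x t a Ux -> abs_cvg_twisted_geom y t b Uy ->
  abs_cvg_twisted_geom t 1 (fun=> 0%N) Ot ->
  (partial_sum (fun m : nat * nat * nat =>
      let: (i, j, k) := m in
      ((coef_pos (a i) (b j) i j k)%:R - (coef_neg (a i) (b j) i j k)%:R)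
        * x ^+ i * y ^+ j * t ^+ k : K^o) @ totally
    --> ((Dx * Oy + Ox * Dy + (1 + t) * (Ux * Uy) - (1 + t) * (Ux * Dy)
          - (1 + t) * (Dx * Uy)) * Ot : K^o))%classic.
Proof.
move=> cDx cDy cOx cOy cUx cUy cOt.
pose T al be d := partial_sum (epi_term al be d x y t : _ -> K^o).
have pos := cvgD (cvgD (cvgD (cvg_epi_term (d := 0%N) cDx cOy cOt)
    (cvg_epi_term (d := 0%N) cOx cDy cOt))
    (cvg_epi_term (d := 0%N) cUx cUy cOt)) (cvg_epi_term (d := 1%N) cUx cUy cOt).
have neg := cvgD (cvgD (cvgD (cvg_epi_term (d := 0%N) cUx cDy cOt)
    (cvg_epi_term (d := 1%N) cUx cDy cOt))
    (cvg_epi_term (d := 0%N) cDx cUy cOt)) (cvg_epi_term (d := 1%N) cDx cUy cOt).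
set u := (X in partial_sum X); set v := (X in cvg_to _ (nbhs X)).
have -> : v =
    t ^+ 0 * (Dx * Oy * Ot) + t ^+ 0 * (Ox * Dy * Ot) + t ^+ 0 * (Ux * Uy * Ot)
      + t ^+ 1 * (Ux * Uy * Ot)
    - (t ^+ 0 * (Ux * Dy * Ot) + t ^+ 1 * (Ux * Dy * Ot)
      + t ^+ 0 * (Dx * Uy * Ot) + t ^+ 1 * (Dx * Uy * Ot)).
  by rewrite /v; ring.
have -> : partial_sum u = fun J =>
    T id (fun=> 0%N) 0%N J + T (fun=> 0%N) id 0%N J + T a b 0%N J + T a b 1%N J
    - (T a id 0%N J + T a id 1%N J + T id b 0%N J + T id b 1%N J); last first.
  by apply: cvgB; [exact: pos|exact: neg].
apply/funext => J; rewrite /T /partial_sum -!big_split -sumrB.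
apply: eq_bigr => -[[[i j] k] /= _] _.
rewrite /coef_pos /coef_neg !natrD !addn0 add0n; ring.
Qed.

(** Here X and Y are x^r and y^s: only their values matter, as the closed forms
    of the one-variable series involve the exponents through them. *)
Lemma ratfunE (K : fieldType) (x y t X Y : K) :
  1 - t * X != 0 -> 1 - t * Y != 0 -> 1 - x != 0 -> 1 - y != 0 ->
  1 - t != 0 -> 1 - t * x != 0 -> 1 - t * y != 0 ->
  let O z := (1 - z)^-1 in let D z := (1 - t * z)^-1 in
  let U z Z := (1 - Z) / ((1 - z) * (1 - t * Z)) in
  (D x * O y + O x * D y + (1 + t) * (U x X * U y Y)
    - (1 + t) * (U x X * D y) - (1 + t) * (D x * U y Y)) / (1 - t)
  = ((1 - x * y) * (1 - t * X) * (1 - t * Y)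
     + (1 - t ^+ 2) * (x - X) * (y - Y))
  / ((1 - t * X) * (1 - t * Y) * (1 - x) * (1 - y) * (1 - t * x) * (1 - t * y)).
Proof.
move=> ? ? ? ? ? ? ? O D U; rewrite /O /D /U; field.
by do ?[apply/andP; split].
Qed.

Unset Implicit Arguments.

(* On [R[i]], [0 <= z] says that [z] is real and nonnegative. *)
Theorem lemma1p3 (R : realType) (r s : nat) (r_gt0 : (0 < r)%N)
    (s_gt0 : (0 < s)%N) :
  exists c : nat -> nat -> nat -> R[i],
    power_series_on_polydisc (@ratfun R[i] r s) c
    /\ forall i j k : nat, 0 <= c i j k.
Proof.
exists (fun i j k => (coef_pos (i %/ r) (j %/ s) i j k)%:R
                   - (coef_neg (i %/ r) (j %/ s) i j k)%:R).
split=> [x y t x1 y1 t1|i j k]; last first.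
  by rewrite subr_ge0 ler_nat coef_neg_le_pos // leq_div.
have t1' := ltW t1.
rewrite /ratfun -ratfunE ?subr1_neq0 ?normrMX_lt1 //; last 2 first.
- by rewrite -[x]expr1 normrMX_lt1.
- by rewrite -[y]expr1 normrMX_lt1.
apply: cvg_coef.
- exact: abs_cvg_twisted_geom_id.
- exact: abs_cvg_twisted_geom_id.
- exact: abs_cvg_twisted_geom_cst0.
- exact: abs_cvg_twisted_geom_cst0.
- exact: abs_cvg_twisted_geom_div.
- exact: abs_cvg_twisted_geom_div.
- exact: abs_cvg_twisted_geom_cst0.
Qed.
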